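(* Let $A\in\mathbb{R}^{m\times n}$, $b\in\mathbb{R}^m$, $c\in\mathbb{R}^n$, $d=(A,b,c)$, and suppose that the condition numbers $\delta_P$ and $\delta_D$ of $d$ are both positive. Let $(x^*,u^* )$ be any primal-dual optimal pair for the linear program $\min c^Tx$ s.t. $Ax=b$, $x\ge0$ and its dual $\max b^Tu$ s.t. $c-A^Tu\ge0$, with $c^Tx^*\neq0$. Let $\bar u\in\mathbb{R}^m$, $\bar x\in\mathbb{R}^n$ be arbitrary and $C_*:=\max(\|x^*-\bar x\|,\|u^*-\bar u\|)$. Let $\epsilon>0$ and $\delta>0$ be given, and suppose $\beta>0$ satisfies the three lower bounds $$\beta\ge\frac{10\,C_*}{\|d\|\min(\delta_P,\delta_D)},$$ $$\beta\ge\frac{1}{\delta|c^Tx^*|}\left[\frac{25\,C_*}{\delta_P\delta_D}+6C_*^2+\sqrt6\,\|\bar x\|\,C_*\right],$$ $$\beta\ge\frac1\epsilon\left[(1+\sqrt2)\,C_*+\frac{25\,C_*}{2\delta_P\delta_D}\right].$$ Let $x(\beta)$ be the unique minimizer over $x\ge0$ of $$f_\beta(x):=c^Tx-\bar u^T(Ax-b)+\frac\beta2\|Ax-b\|^2+\frac1{2\beta}\|x-\bar x\|^2,$$ and let $\hat x\ge0$ satisfy $$\beta^{-1}\|\hat x-x(\beta)\|^2\le f_\beta(\hat x)-f_\beta(x(\beta))\le\bar\epsilon,\qquad \bar\epsilon:=\frac{C_{20}^2}{\beta^3},\quad C_{20}:=\frac{25\,C_*}{2\|d\|\delta_P\delta_D}.$$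 Then $$\|A\hat x-b\|_\infty\le\epsilon\qquad\text{and}\qquad|c^T\hat x-c^Tx^*|\le\delta|c^Tx^*|.$$
   Context: $\|\cdot\|$ on vectors is the Euclidean norm. For data $d=(A,b,c)$, $\|d\|:=\max\{\|A\|_F,\|b\|_2,\|c\|_2\}$. Throughout, $A$ is assumed to have full row rank $m$. Let $\mathrm{Pri}\emptyset$ be the set of data $d'=(A',b',c')$ (same dimensions) for which the primal program $\min c'^Tx$ s.t. $A'x=b'$, $x\ge0$ is infeasible, and $\mathrm{Dual}\emptyset$ the set of data for which the dual program $\max b'^Tu$ s.t. $c'-A'^Tu\ge0$ is infeasible. Define $$\delta_P:=\frac{\mathrm{dist}(d,\mathrm{Pri}\emptyset)}{\|d\|},\qquad \delta_D:=\frac{\mathrm{dist}(d,\mathrm{Dual}\emptyset)}{\|d\|},$$ where $\mathrm{dist}(d,S)=\inf_{d'\in S}\|d-d'\|$. When $\delta_P,\delta_D>0$ both programs are feasible, so both have solutions. *)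

(* Defs.v *)
From HB Require Import structures.
From mathcomp Require Import all_boot all_order all_algebra.
From mathcomp Require Import all_classical all_reals all_analysis.
Import Order.TTheory GRing.Theory Num.Theory.
Import numFieldNormedType.Exports.

Set Implicit Arguments.
Unset Strict Implicit.
Unset Printing Implicit Defensive.

Local Open Scope classical_set_scope.
Local Open Scope ring_scope.

Definition dotv (R : realType) k (u v : 'cV[R]_k) : R := (u^T *m v) 0 0.

(* The norm `|A| of the library on matrices (hence on vectors) is the largest
   absolute value of an entry; fnorm and enorm are the Frobenius norm and the
   Euclidean norm. *)
Definition fnorm (R : realType) m n (A : 'M[R]_(m, n)) : R :=
  Num.sqrt (\sum_i \sum_j A i j ^+ 2).

Definition enorm (R : realType) k (v : 'cV[R]_k) : R :=
  Num.sqrt (\sum_i v i 0 ^+ 2).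

Definition nonneg (R : realType) k (v : 'cV[R]_k) : Prop :=
  forall i, 0 <= v i 0.

Definition lpdata (R : realType) (m n : nat) : Type :=
  ('M[R]_(m, n) * 'cV[R]_m * 'cV[R]_n)%type.

Definition lpA (R : realType) m n (d : lpdata R m n) : 'M[R]_(m, n) := d.1.1.
Definition lpb (R : realType) m n (d : lpdata R m n) : 'cV[R]_m := d.1.2.
Definition lpc (R : realType) m n (d : lpdata R m n) : 'cV[R]_n := d.2.

Definition dnorm (R : realType) m n (d : lpdata R m n) : R :=
  Num.max (fnorm (lpA d)) (Num.max (enorm (lpb d)) (enorm (lpc d))).

Definition primal_feasible (R : realType) m n (d : lpdata R m n)
    (x : 'cV[R]_n) : Prop :=
  lpA d *m x = lpb d /\ nonneg x.

Definition dual_feasible (R : realType) m n (d : lpdata R m n)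
    (u : 'cV[R]_m) : Prop :=
  nonneg (lpc d - (lpA d)^T *m u).

Definition primal_optimal (R : realType) m n (d : lpdata R m n)
    (x : 'cV[R]_n) : Prop :=
  primal_feasible d x /\
  forall y, primal_feasible d y -> dotv (lpc d) x <= dotv (lpc d) y.

Definition dual_optimal (R : realType) m n (d : lpdata R m n)
    (u : 'cV[R]_m) : Prop :=
  dual_feasible d u /\
  forall w, dual_feasible d w -> dotv (lpb d) w <= dotv (lpb d) u.

Definition Pri_empty (R : realType) m n : set (lpdata R m n) :=
  [set d | ~ exists x, primal_feasible d x].

Definition Dual_empty (R : realType) m n : set (lpdata R m n) :=
  [set d | ~ exists u, dual_feasible d u].

(* The library's real inf of the empty set is 0, not +oo. Pri_empty and
   Dual_empty are nonempty as soon as m and n are positive; if m or n is 0 then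
   every primal optimal solution has objective value 0. *)
Definition dist (R : realType) m n (d : lpdata R m n)
    (S : set (lpdata R m n)) : R :=
  inf [set dnorm (d - d') | d' in S].

Definition delta_P (R : realType) m n (d : lpdata R m n) : R :=
  dist d (@Pri_empty R m n) / dnorm d.

Definition delta_D (R : realType) m n (d : lpdata R m n) : R :=
  dist d (@Dual_empty R m n) / dnorm d.

Definition f_beta (R : realType) m n (d : lpdata R m n) (ubar : 'cV[R]_m)
    (xbar : 'cV[R]_n) (beta : R) (x : 'cV[R]_n) : R :=
  let r := lpA d *m x - lpb d in
  dotv (lpc d) x - dotv ubar r + beta / 2 * enorm r ^+ 2
    + (2 * beta)^-1 * enorm (x - xbar) ^+ 2.

(* For beta > 0 the function f_beta is strongly convex, so it has exactly one
   such minimizer. *)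
Definition minimizes_f_beta (R : realType) m n (d : lpdata R m n)
    (ubar : 'cV[R]_m) (xbar : 'cV[R]_n) (beta : R) (x : 'cV[R]_n) : Prop :=
  nonneg x /\
  forall y, nonneg y -> f_beta d ubar xbar beta x <= f_beta d ubar xbar beta y.

(* Main.v *)
(* The minimizer x(beta), together with u(beta) = ubar - beta (A x(beta) - b),
   is one proximal step from (xbar, ubar) for the monotone operator of the
   primal-dual optimality system, hence moves by at most sqrt 2 * C.  This bounds
   the residual A x(beta) - b, and bounds the error in the objective value in
   terms of |ustar|.  A perturbation of d of size about 1 / |ustar| turns ustar
   into a Farkas certificate of primal infeasibility, which bounds |ustar| by
   3 / (delta_P delta_D); the negative part of the optimal value that enters this
   bound is controlled in the same way by perturbing the dual through xstar.
   Strong duality, which makes xstar and ustar complementary, is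
   derived from Farkas' lemma. *)
Require Import Defs.
From mathcomp Require Import all_boot all_order all_algebra.
From mathcomp Require Import all_classical all_reals all_analysis.
From mathcomp Require Import ring lra.
Import Order.TTheory GRing.Theory Num.Theory.
Import numFieldNormedType.Exports.

Set Implicit Arguments.
Unset Strict Implicit.
Unset Printing Implicit Defensive.

Local Open Scope ring_scope.

(** * Inner product, Euclidean norm and Frobenius norm *)

Section EuclideanNorm.
Context {R : realType}.

Section Dot.
Context {k : nat}.
Implicit Types u v w : 'cV[R]_k.

Lemma dotvE u v : dotv u v = \sum_i u i 0 * v i 0.
Proof. by rewrite /dotv mxE; apply: eq_bigr => i _; rewrite mxE. Qed.

Lemma dotvC u v : dotv u v = dotv v u.
Proof. by rewrite !dotvE; apply: eq_bigr => i _; rewrite mulrC. Qed.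

Lemma dotvDl u v w : dotv (u + v) w = dotv u w + dotv v w.
Proof. by rewrite /dotv linearD mulmxDl mxE. Qed.

Lemma dotvNl u v : dotv (- u) v = - dotv u v.
Proof. by rewrite /dotv linearN mulNmx mxE. Qed.

Lemma dotvZl a u v : dotv (a *: u) v = a * dotv u v.
Proof. by rewrite /dotv linearZ -scalemxAl mxE. Qed.

Lemma dotvDr u v w : dotv u (v + w) = dotv u v + dotv u w.
Proof. by rewrite dotvC dotvDl ![dotv _ u]dotvC. Qed.

Lemma dotvNr u v : dotv u (- v) = - dotv u v.
Proof. by rewrite dotvC dotvNl dotvC. Qed.

Lemma dotvZr a u v : dotv u (a *: v) = a * dotv u v.
Proof. by rewrite dotvC dotvZl dotvC. Qed.

Lemma dotvr0 u : dotv u 0 = 0.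
Proof. by rewrite -(scale0r u) dotvZr mul0r. Qed.

Definition dotv_lin := (dotvDl, dotvDr, dotvNl, dotvNr, dotvZl, dotvZr).

Lemma dotv_ge0 u v : nonneg u -> nonneg v -> 0 <= dotv u v.
Proof. by move=> u0 v0; rewrite dotvE sumr_ge0 // => i _; rewrite mulr_ge0. Qed.

Lemma dotvv_ge0 v : 0 <= dotv v v.
Proof. by rewrite dotvE sumr_ge0 // => i _; rewrite -expr2 sqr_ge0. Qed.

Lemma enormE v : enorm v = Num.sqrt (dotv v v).
Proof. by rewrite dotvE; congr Num.sqrt; apply: eq_bigr => i _; rewrite expr2. Qed.

Lemma sqr_enorm v : enorm v ^+ 2 = dotv v v.
Proof. by rewrite enormE sqr_sqrtr // dotvv_ge0. Qed.

Lemma enorm_ge0 v : 0 <= enorm v.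
Proof. exact: sqrtr_ge0. Qed.

Lemma enorm0 : enorm (0 : 'cV[R]_k) = 0.
Proof. by rewrite enormE dotvr0 sqrtr0. Qed.

Lemma enorm_gt0 v : (0 < enorm v) = (v != 0).
Proof.
rewrite /enorm sqrtr_gt0 lt0r sumr_ge0 ?andbT => [|i _]; last exact: sqr_ge0.
congr (~~ _); rewrite psumr_eq0 => [|i _]; last exact: sqr_ge0.
apply/allP/eqP => [v0|-> i _]; last by rewrite mxE expr0n /= eqxx.
apply/colP => i; rewrite mxE; apply/eqP.
by rewrite -sqrf_eq0; apply: (implyP (v0 i _)); rewrite ?mem_index_enum.
Qed.

Lemma enormN v : enorm (- v) = enorm v.
Proof. by rewrite !enormE !dotv_lin opprK. Qed.

Lemma enormZ a v : enorm (a *: v) = `|a| * enorm v.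
Proof.
by rewrite !enormE !dotv_lin mulrA -expr2 sqrtrM ?sqr_ge0 // sqrtr_sqr.
Qed.

Lemma cauchy_schwarz u v : `|dotv u v| <= enorm u * enorm v.
Proof.
have [->|v0] := eqVneq v 0.
  by rewrite dotvr0 normr0 mulr_ge0 // enorm_ge0.
have vv : 0 < dotv v v by rewrite -sqr_enorm exprn_gt0 // enorm_gt0.
(* This vector is [dotv v v] times the component of u orthogonal to v. *)
have := dotvv_ge0 (dotv v v *: u - dotv u v *: v).
rewrite !dotv_lin (dotvC v u) => h.
rewrite -sqrtr_sqr !enormE -sqrtrM ?dotvv_ge0 // ler_wsqrtr //.
by rewrite -(ler_pM2l vv); lra.
Qed.

Lemma le_enormD u v : enorm (u + v) <= enorm u + enorm v.
Proof.
rewrite -(@ler_pXn2r _ 2) ?nnegrE ?addr_ge0 ?enorm_ge0 //.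
rewrite sqrrD !sqr_enorm !dotv_lin (dotvC v u).
by have := le_trans (ler_norm _) (cauchy_schwarz u v); lra.
Qed.

Lemma ler_coord_enorm v i : `|v i 0| <= enorm v.
Proof.
rewrite -sqrtr_sqr ler_wsqrtr // (bigD1 i) //= lerDl sumr_ge0 // => j _.
exact: sqr_ge0.
Qed.

End Dot.

Lemma dotv_mulmx m n (A : 'M[R]_(m, n)) u x :
  dotv u (A *m x) = dotv (A^T *m u) x.
Proof. by rewrite /dotv trmx_mul trmxK mulmxA. Qed.

Lemma mul_outer m n (u : 'cV[R]_m) (v x : 'cV[R]_n) :
  u *m v^T *m x = dotv v x *: u.
Proof. by rewrite -mulmxA [v^T *m x]mx11_scalar mul_mx_scalar. Qed.

Lemma fnorm_ge0 m n (A : 'M[R]_(m, n)) : 0 <= fnorm A.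
Proof. exact: sqrtr_ge0. Qed.

Lemma enorm_mulmx m n (A : 'M[R]_(m, n)) x :
  enorm (A *m x) <= fnorm A * enorm x.
Proof.
rewrite /fnorm /enorm -sqrtrM; last first.
  by apply: sumr_ge0 => i _; apply: sumr_ge0 => j _; exact: sqr_ge0.
apply: ler_wsqrtr; rewrite mulr_suml; apply: ler_sum => i _.
have -> : (A *m x) i 0 = dotv (row i A)^T x.
  by rewrite dotvE mxE; apply: eq_bigr => j _; rewrite !mxE.
have -> : \sum_j A i j ^+ 2 = enorm (row i A)^T ^+ 2.
  rewrite sqr_enorm dotvE; apply: eq_bigr => j _.
  by rewrite !mxE expr2.
have -> : \sum_j x j 0 ^+ 2 = enorm x ^+ 2.
  by rewrite sqr_enorm dotvE; apply: eq_bigr => j _; rewrite expr2.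
rewrite -exprMn -real_normK ?num_real //.
by rewrite ler_pXn2r ?nnegrE ?mulr_ge0 ?enorm_ge0 // cauchy_schwarz.
Qed.

(** Measures the rank-one perturbations of A used below to reach infeasible data. *)
Lemma fnorm_outer m n (u : 'cV[R]_m) (v : 'cV[R]_n) a :
  fnorm (a *: (u *m v^T)) = `|a| * (enorm u * enorm v).
Proof.
rewrite /enorm -sqrtrM; last by apply: sumr_ge0 => i _; exact: sqr_ge0.
rewrite -sqrtr_sqr -sqrtrM ?sqr_ge0 //; congr Num.sqrt.
rewrite mulr_suml mulr_sumr; apply: eq_bigr => i _.
rewrite mulr_sumr mulr_sumr; apply: eq_bigr => j _.
by rewrite !mxE big_ord1 !mxE !exprMn.
Qed.

End EuclideanNorm.

(** * Farkas' lemma *)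

(* Bartl's induction on the number of inequalities. *)
Lemma farkas (R : realType) k n (M : 'M[R]_(k, n)) (c : 'rV[R]_n) :
  (forall x : 'cV_n, nonneg (M *m x) -> 0 <= (c *m x) 0 0) ->
  exists l : 'rV_k, (forall j, 0 <= l 0 j) /\ c = l *m M.
Proof.
elim: k M c => [|k IH] M c hM.
  exists 0; split=> [j|]; first by rewrite mxE.
  rewrite mul0mx; apply/rowP => j; rewrite mxE.
  have h a : 0 <= a * c 0 j.
    have <- : (c *m (a *: delta_mx j 0 : 'cV_n)) 0 0 = a * c 0 j.
      by rewrite -scalemxAr -colE !mxE.
    by apply: hM => -[].
  have := h 1; have := h (-1); lra.
move: M hM; rewrite -[k.+1]/(1 + k)%N => M; rewrite -(vsubmxK M).
move: (usubmx M) (dsubmx M) => a M' hM.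
have hM1 (x : 'cV_n) : 0 <= (a *m x) 0 0 -> nonneg (M' *m x) -> 0 <= (c *m x) 0 0.
  move=> ax Mx; apply: hM; rewrite mul_col_mx => i.
  by rewrite mxE; case: (fintype.split i) => j; rewrite ?ord1.
have ext (l0 : 'rV_1) (l : 'rV_k) : 0 <= l0 0 0 -> (forall j, 0 <= l 0 j) ->
    c = l0 *m a + l *m M' ->
    exists l : 'rV_(1 + k), (forall j, 0 <= l 0 j) /\ c = l *m col_mx a M'.
  move=> h0 hl ->; exists (row_mx l0 l); split; last by rewrite mul_row_col.
  by move=> j; rewrite mxE; case: (fintype.split j) => i; rewrite ?ord1.
(* If the rows of M' alone imply the inequality, a gets multiplier 0. Otherwise some x has M' x >= 0
   and c x < 0, and then a x < 0 by [hM1]. *)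
have [/IH [l [l0 lE]]|] := pselect (forall x, nonneg (M' *m x) -> 0 <= (c *m x) 0 0).
  by apply: (ext 0 l); rewrite ?mxE // mul0mx add0r.
move=> /existsNP[x /not_implyP[Mx /negP]]; rewrite -ltNge => cx.
have ax : (a *m x) 0 0 < 0.
  by rewrite ltNge; apply/negP => ax; have := hM1 _ ax Mx; lra.
pose s := (a *m x) 0 0; have s0 : s != 0 by rewrite lt_eqF.
have subE (B C : 'M[R]_1) t : (B - t *: C) 0 0 = B 0 0 - t * C 0 0 by rewrite !mxE.
(* Multiples of a are subtracted so that every row, and c, vanishes at x. Evaluating the new rows at
   y amounts to evaluating the old ones at z, the projection of y along x onto the kernel of a. *)
have [y|l [l0 lE]] := IH (M' - s^-1 *: (M' *m x *m a)) (c - s^-1 *: (c *m x *m a)).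
  pose z := y - (s^-1 * (a *m y) 0 0) *: x.
  have zE p (B : 'M[R]_(p, n)) :
      (B - s^-1 *: (B *m x *m a)) *m y = B *m z.
    rewrite mulmxBl mulmxBr -scalemxAl -!mulmxA -scalemxAr -scalerA.
    by rewrite [in LHS](mx11_scalar (a *m y)) mul_mx_scalar -scalemxAr.
  rewrite !zE => Mz; apply: hM1 => //.
  by rewrite mulmxBr -scalemxAr subE -/s mulrAC mulVf // mul1r subrr.
(* The multiplier of a is (c - l M') x / (a x). Both are nonpositive at x, since c x < 0 <= l M' x
   and a x < 0. *)
apply: (ext (s^-1 *: (c *m x - l *m M' *m x)) l) => //.
  rewrite mxE nmulr_rge0 ?invr_lt0 // -[l *m M' *m x]scale1r subE mul1r.
  rewrite subr_le0 (le_trans (ltW cx)) // -mulmxA mxE sumr_ge0 // => j _.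
  by rewrite mulr_ge0.
move/eqP: lE; rewrite subr_eq => /eqP cE; rewrite {1}cE.
rewrite mulmxBr -!scalemxAl -scalemxAr mulmxBl scalerBr !mulmxA.
by rewrite [LHS]addrC [LHS]addrCA [RHS]addrC.
Qed.

(** * Weak and strong duality *)

Section LinearProgram.
Context {R : realType} {m n : nat}.
Implicit Types (d : lpdata R m n) (x y : 'cV[R]_n) (u : 'cV[R]_m).

Lemma weak_duality d x u :
  primal_feasible d x -> dual_feasible d u ->
  dotv (lpb d) u <= dotv (lpc d) x.
Proof.
move=> [<- x0] u0; have := dotv_ge0 u0 x0.
by rewrite dotvDl dotvNl -dotv_mulmx subr_ge0 dotvC.
Qed.

(* If y recedes in the homogenized program and undercuts t * (c.x), then so
   does the feasible point (x + y) / (1 + t), with no case distinction on t. *)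
Lemma primal_optimal_dual d x :
  primal_optimal d x ->
  exists u, dual_feasible d u /\ dotv (lpc d) x <= dotv (lpb d) u.
Proof.
case: d => -[A b] c [[/= Ax x0] xmin]; rewrite /dual_feasible /lpA /lpb /lpc /=.
set k := dotv c x.
(* Homogenization: N (y, t) = A y - t b. The rows of N and - N together encode N (y, t) = 0, and the
   identity block encodes y, t >= 0. *)
pose N : 'M[R]_(m, n + 1) := row_mx A (- b).
have [z|l [l0 lE]] := @farkas R _ _ (col_mx 1%:M (col_mx N (- N)))
    (row_mx c^T (- k)%:M).
  rewrite -(vsubmxK z); move: (usubmx z) (dsubmx z) => y t {z} h.
  have h0 : nonneg (col_mx y t).
    by move=> i; have := h (lshift _ i); rewrite mul_col_mx col_mxEu mul1mx.
  have y0 : nonneg y by move=> i; have := h0 (lshift _ i); rewrite col_mxEu.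
  have t0 : 0 <= t 0 0 by have := h0 (rshift _ 0); rewrite col_mxEd.
  have Nz : N *m col_mx y t = 0.
    apply/colP => i; rewrite [RHS]mxE; apply/eqP; rewrite eq_le; apply/andP; split.
      have := h (rshift _ (rshift _ i)).
      by rewrite !mul_col_mx !col_mxEd mulNmx mxE oppr_ge0.
    by have := h (rshift _ (lshift _ i)); rewrite !mul_col_mx col_mxEd col_mxEu.
  have Ay : A *m y = t 0 0 *: b.
    move: Nz; rewrite mul_row_col mulNmx [t in b *m t]mx11_scalar mul_mx_scalar.
    by move/eqP; rewrite subr_eq0 => /eqP.
  have t1 : 0 < 1 + t 0 0 by rewrite ltr_wpDr.
  have /xmin : primal_feasible (A, b, c) ((1 + t 0 0)^-1 *: (x + y)).
    split=> /= [|i]; last by rewrite !mxE mulr_ge0 ?addr_ge0 // invr_ge0 ltW.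
    rewrite /lpA /lpb /= in Ax *.
    have E : b + t 0 0 *: b = (1 + t 0 0) *: b by rewrite scalerDl scale1r.
    by rewrite -scalemxAr mulmxDr Ax Ay E scalerA mulVf ?scale1r // gt_eqF.
  rewrite /lpc /= -/k !dotv_lin -/k ler_pdivlMl //.
  rewrite mul_row_col mxE mul_scalar_mx -/(dotv c y) mxE.
  by lra.
rewrite -(hsubmxK l) mul_row_col mulmx1 -(hsubmxK (rsubmx l)) mul_row_col in lE.
rewrite mulmxN -mulmxBl in lE.
(* The dual solution is the difference of the multipliers of N and - N. The multipliers of y >= 0
   become its slack, and that of t >= 0 gives k <= b.v. *)
set v := (_ - _) in lE; rewrite -(hsubmxK (lsubmx l)) mul_mx_row add_row_mx in lE.
case/eq_row_mx: lE => cE kE.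
exists v^T; split.
  move=> i; have -> : c = (c^T)^T by rewrite trmxK.
  by rewrite cE -trmx_mul -linearB /= addrK !mxE.
have := congr1 (fun B : 'M[R]_1 => B 0 0) kE.
rewrite !mxE mulr1n.
have := l0 (lshift _ (rshift _ 0)).
have -> : \sum_j v 0 j * (- b) j 0 = - dotv b v^T.
  by rewrite dotvE -sumrN; apply: eq_bigr => j _; rewrite !mxE mulrN mulrC.
by lra.
Qed.

Lemma strong_duality d x u :
  primal_optimal d x -> dual_optimal d u -> dotv (lpc d) x = dotv (lpb d) u.
Proof.
move=> hx [u0 umax]; have [v [/umax vu cv]] := primal_optimal_dual hx.
by apply/eqP; rewrite eq_le (le_trans cv vu) weak_duality //; case: hx.
Qed.

(** * Distances to infeasibility and the size of dual solutions *)

Lemma fnorm_le_dnorm d : fnorm (lpA d) <= dnorm d.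
Proof. by rewrite /dnorm le_max lexx. Qed.

Lemma enormb_le_dnorm d : enorm (lpb d) <= dnorm d.
Proof. by rewrite /dnorm !le_max lexx orbT. Qed.

Lemma enormc_le_dnorm d : enorm (lpc d) <= dnorm d.
Proof. by rewrite /dnorm !le_max lexx !orbT. Qed.

Lemma dnorm_ge0 d : 0 <= dnorm d.
Proof. exact: le_trans (fnorm_ge0 _) (fnorm_le_dnorm d). Qed.

Lemma dist_le d d' (S : set (lpdata R m n)) : S d' -> dist d S <= dnorm (d - d').
Proof.
move=> Sd'; apply: ge_inf; last by exists d'.
by exists 0 => _ [d1 _ <-]; exact: dnorm_ge0.
Qed.

(* The data (A - u c^T / |u|^2, b + s u / |u|^2, c) have u as a Farkas
   certificate of primal infeasibility. *)
Lemma dist_Pri_empty_le d u (s : R) :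
  dual_feasible d u -> - dotv (lpb d) u < s ->
  dist d (@Pri_empty R m n) * enorm u <= Num.max (enorm (lpc d)) `|s|.
Proof.
case: d => -[A b] c; rewrite /dual_feasible /lpA /lpb /lpc /= => u0 bus.
have [->|un0] := eqVneq u 0.
  by rewrite enorm0 mulr0 le_max normr_ge0 orbT.
have t0 : 0 < enorm u by rewrite enorm_gt0.
set t := enorm u in t0 *; have tn0 : t != 0 by rewrite gt_eqF.
have uu : dotv u u = t ^+ 2 by rewrite -sqr_enorm.
rewrite -ler_pdivlMr //.
pose d' : lpdata R m n := (A - t ^- 2 *: (u *m c^T), b + (s * t ^- 2) *: u, c).
have Sd' : Pri_empty d'.
  move=> [x [/= Ax x0]]; rewrite /lpA /lpb /= in Ax.
  (* Pairing the perturbed equation with u gives - (c - A^T u).x = b.u + s, whose left side is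
     nonpositive and right side positive. *)
  have := congr1 (dotv u) Ax.
  rewrite mulmxBl -scalemxAl mul_outer.
  rewrite !dotv_lin dotv_mulmx uu (dotvC u b).
  rewrite [t ^- 2 * _]mulrCA -[s * _ * _]mulrA mulVf ?expf_neq0 // !mulr1.
  by have := dotv_ge0 u0 x0; rewrite !dotv_lin; lra.
apply: le_trans (dist_le _ Sd') _.
rewrite /dnorm /lpA /lpb /lpc /= !subKr opprD addNKr subrr fnorm_outer enormN enormZ -/t.
rewrite enorm0.
rewrite normrM normfV normrX (gtr0_norm t0) !ge_max.
have tt : t ^- 2 * t = t^-1 by rewrite expr2 invfM mulfVK.
rewrite mulrA -[`|s| / _ * _]mulrA !tt (mulrC t^-1) !ler_pM2r ?invr_gt0 //.
by rewrite !le_max !lexx orbT /= divr_ge0 ?le_max ?enorm_ge0 // ltW.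
Qed.

(** For the data (A - b x^T / |x|^2, b, c) the vector x lies in the kernel of the matrix and c.x <
    0, so it certifies dual infeasibility. The perturbation has norm |b| / |x|. *)
Lemma dist_Dual_empty_le d x :
  primal_feasible d x -> dotv (lpc d) x < 0 ->
  dist d (@Dual_empty R m n) * enorm x <= enorm (lpb d).
Proof.
case: d => -[A b] c [/=]; rewrite /lpA /lpb /lpc /= => Ax x0 cx.
have xn0 : x != 0.
  by apply: contraTneq cx => ->; rewrite dotvr0 ltxx.
have t0 : 0 < enorm x by rewrite enorm_gt0.
set t := enorm x in t0 *; have tn0 : t != 0 by rewrite gt_eqF.
have xx : dotv x x = t ^+ 2 by rewrite -sqr_enorm.
rewrite -ler_pdivlMr //.
pose d' : lpdata R m n := (A - t ^- 2 *: (b *m x^T), b, c).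
have Sd' : Dual_empty d'.
  move=> [u /= u0]; have := dotv_ge0 u0 x0.
  rewrite /d' /lpA /lpc /= dotvDl dotvNl -dotv_mulmx.
  rewrite mulmxBl -scalemxAl mul_outer.
  rewrite xx scalerA mulVf ?expf_neq0 // scale1r Ax subrr.
  by rewrite dotvr0; lra.
apply: le_trans (dist_le _ Sd') _.
rewrite /dnorm /lpA /lpb /lpc /= subKr !subrr fnorm_outer -/t.
rewrite !enorm0 normfV normrX (gtr0_norm t0) !ge_max divr_ge0 ?enorm_ge0 ?(ltW t0) //=.
have tt : t ^- 2 * t = t^-1 by rewrite expr2 invfM mulfVK.
by rewrite andbT mulrCA tt.
Qed.

(** Taking e = |d| yields delta_D <= 2. In the data (0, 0, - e e_i) the i-th dual constraint reads -
    e >= 0. *)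
Lemma dist_Dual_empty_le_dnorm d (i : 'I_n) (e : R) :
  0 < e -> dist d (@Dual_empty R m n) <= dnorm d + e.
Proof.
move=> e0; pose d' : lpdata R m n := (0, 0, - (e *: delta_mx i 0)).
have Sd' : Dual_empty d'.
  move=> [u /(_ i)]; rewrite /d' /lpA /lpc /= trmx0 mul0mx subr0 !mxE !eqxx.
  by rewrite mulr1 oppr_ge0 leNgt e0.
apply: le_trans (dist_le _ Sd') _.
have de : dnorm d <= dnorm d + e by rewrite lerDl ltW.
rewrite {1}/dnorm {1}/lpA {1}/lpb {1}/lpc /= !subr0 opprK !ge_max.
rewrite (le_trans (fnorm_le_dnorm d)) //=.
rewrite (le_trans (enormb_le_dnorm d)) //=.
apply: le_trans (le_enormD _ _) _; rewrite lerD ?enormc_le_dnorm //.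
rewrite enormZ gtr0_norm // ler_piMr ?(ltW e0) //.
rewrite /enorm (bigD1 i) //= big1 => [|j /negPf ji]; rewrite mxE ?eqxx ?ji /=.
  by rewrite expr1n addr0 sqrtr1.
by rewrite expr0n.
Qed.

(** The constant 3 comes from delta_P |u| <= 1 + 1 / delta_D and delta_D <= 2. *)
Lemma enorm_dual_optimal_le d x u :
  0 < delta_P d -> 0 < delta_D d ->
  primal_optimal d x -> dual_optimal d u -> dotv (lpc d) x != 0 ->
  enorm u <= 3 / (delta_P d * delta_D d).
Proof.
move=> dP0 dD0 hx hu k0; have kE := strong_duality hx hu.
set k := dotv (lpc d) x in k0 kE; set N := dnorm d.
have N0 : 0 < N.
  (* Division by zero yields 0, so |d| = 0 would contradict 0 < delta_P. *)
  rewrite lt_neqAle dnorm_ge0 andbT; apply/eqP => N0.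
  by move: dP0; rewrite /delta_P -/N -N0 invr0 mulr0 ltxx.
have [i _] : exists i : 'I_n, true.
  have [[i]|no] := pselect (inhabited 'I_n); first by exists i.
  case/eqP: k0; rewrite /k dotvE big1 // => i; by case: no.
have PE : dist d (@Pri_empty R m n) = delta_P d * N by rewrite divfK // gt_eqF.
have DE : dist d (@Dual_empty R m n) = delta_D d * N by rewrite divfK // gt_eqF.
have dD2 : delta_D d <= 2.
  have := dist_Dual_empty_le_dnorm d i N0; rewrite DE -/N => h.
  by rewrite -(ler_pM2r N0); lra.
(* When k < 0, x certifies near-infeasibility of the dual, so |x| <= 1 / delta_D and - k <= |c|
   |x|. *)
have kN : Num.max 0 (- k) <= N / delta_D d.
  rewrite ge_max (divr_ge0 (ltW N0) (ltW dD0)) /= lerNl.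
  have [k_ge0|k_lt0] := leP 0 k.
    by rewrite (le_trans _ k_ge0) // oppr_le0 (divr_ge0 (ltW N0) (ltW dD0)).
  have xD : enorm x <= 1 / delta_D d.
    have := le_trans (dist_Dual_empty_le (proj1 hx) k_lt0) (enormb_le_dnorm d).
    by rewrite DE -/N => h; rewrite ler_pdivlMr // -(ler_pM2r N0); lra.
  rewrite lerNl (le_trans (ler_norm _)) // normrN.
  apply: le_trans (cauchy_schwarz _ _) _.
  rewrite -[leRHS]mul1r mulrCA ler_pM ?enorm_ge0 ?enormc_le_dnorm //.
move: kN; set M := Num.max 0 (- k) => kN.
have M0 : 0 <= M by rewrite le_max lexx.
(* The choice s = N + M exceeds - b.u strictly and also dominates |c|, so the maximum in
   [dist_Pri_empty_le] is s. *)
have sk : - dotv (lpb d) u < N + M.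
  by rewrite -kE ltr_pwDl // le_max lexx orbT.
have := dist_Pri_empty_le (proj1 hu) sk.
rewrite PE (ger0_norm (addr_ge0 (ltW N0) M0)).
have /max_idPr -> : enorm (lpc d) <= N + M.
  by rewrite (le_trans (enormc_le_dnorm d)) // lerDl.
move=> h; have {}h : delta_P d * enorm u * N <= (1 + 1 / delta_D d) * N.
  by move: h kN; lra.
rewrite (ler_pM2r N0) in h.
rewrite (ler_pdivlMr _ _ (mulr_gt0 dP0 dD0)).
have -> : enorm u * (delta_P d * delta_D d) = delta_P d * enorm u * delta_D d.
  by ring.
apply: le_trans (_ : (1 + 1 / delta_D d) * delta_D d <= _).
  by rewrite (ler_pM2r dD0).
by rewrite mulrDl divfK ?gt_eqF // mul1r; lra.
Qed.

(** * The proximal step *)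

(** [f_beta] is quadratic, so its second-order expansion is exact. The linear coefficient is written
    with the multiplier u(beta). *)
Lemma f_beta_line d ubar xbar (beta : R) x (h : 'cV[R]_n) t :
  beta != 0 ->
  f_beta d ubar xbar beta (x + t *: h) - f_beta d ubar xbar beta x =
  t * (dotv (lpc d) h
       - dotv (ubar - beta *: (lpA d *m x - lpb d)) (lpA d *m h)
       + beta^-1 * dotv (x - xbar) h)
  + t ^+ 2 * (beta / 2 * enorm (lpA d *m h) ^+ 2 + (2 * beta)^-1 * enorm h ^+ 2).
Proof.
move=> b0; rewrite /f_beta mulmxDr -scalemxAr ![_ + t *: _ - _]addrAC.
set r := _ *m x - _; set p := x - xbar; set Ah := _ *m h.
move: r p Ah => r p Ah.
rewrite !sqr_enorm !dotv_lin (dotvC h p) (dotvC Ah r).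
by field.
Qed.

Lemma minimizes_f_beta_variation d ubar xbar (beta : R) x y :
  0 < beta -> minimizes_f_beta d ubar xbar beta x -> nonneg y ->
  0 <= dotv (lpc d) (y - x)
       - dotv (ubar - beta *: (lpA d *m x - lpb d)) (lpA d *m (y - x))
       + beta^-1 * dotv (x - xbar) (y - x).
Proof.
move=> b0 [x0 xmin] y0; set h := y - x; set G := _ + _.
pose Q := beta / 2 * enorm (lpA d *m h) ^+ 2 + (2 * beta)^-1 * enorm h ^+ 2.
have Q0 : 0 <= Q.
  by rewrite addr_ge0 // mulr_ge0 ?sqr_ge0 ?divr_ge0 ?invr_ge0 ?mulr_ge0 ?ltW.
rewrite leNgt; apply/negP => G0.
have QG : 0 < Q - G by lra.
(* This t lies in (0, 1] even if Q = 0, and t G + t^2 Q = - t G^2 / (Q - G) < 0, a descent along the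
   segment from x to y. *)
pose t := - G / (Q - G).
have t0 : 0 < t by rewrite divr_gt0 ?oppr_gt0.
have t1 : t <= 1 by rewrite ler_pdivrMr //; lra.
have : nonneg (x + t *: h).
  move=> i; rewrite !mxE.
  have -> : x i 0 + t * (y i 0 - x i 0) = (1 - t) * x i 0 + t * y i 0 by ring.
  by rewrite addr_ge0 // mulr_ge0 ?subr_ge0 // ltW.
move=> /xmin; rewrite -subr_ge0 f_beta_line ?gt_eqF // -/G -/Q.
have -> : t * G + t ^+ 2 * Q = - (t * (G ^+ 2 / (Q - G))).
  by rewrite /t; field; rewrite gt_eqF.
by rewrite oppr_ge0 leNgt mulr_gt0 // divr_gt0 // expr2 nmulr_rgt0.
Qed.

(* With p = x - xbar and q = - beta r, the displacements of the primal and of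
   the dual iterate u(beta) = ubar - beta r, the two inequalities come from the
   variational inequality at y = xstar and from dual feasibility of ustar. *)
Lemma proximal_step_bounds d ubar xbar (beta : R) xstar ustar x :
  let r := lpA d *m x - lpb d in
  let p := x - xbar in
  let q := - (beta *: r) in
  0 < beta -> primal_optimal d xstar -> dual_optimal d ustar ->
  minimizes_f_beta d ubar xbar beta x ->
  beta * (dotv (lpc d) x - dotv (lpc d) xstar) <=
    dotv p (xstar - xbar - p) + dotv q (ustar - ubar - q) - dotv ustar q /\
  - dotv ustar q <= beta * (dotv (lpc d) x - dotv (lpc d) xstar).
Proof.
move=> r p q beta_gt0 xopt uopt xmin.
have [[Ax xs0] _] := xopt; have [u0 _] := uopt.
have Ah : lpA d *m (xstar - x) = - r by rewrite mulmxBr Ax opprB.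
have := minimizes_f_beta_variation beta_gt0 xmin xs0.
rewrite -/r Ah -/p => var.
have kE := strong_duality xopt uopt.
(* The dual slack of ustar is paired with x >= 0, using A x = b + r. *)
have : beta * (dotv ustar r + dotv (lpb d) ustar) <= beta * dotv (lpc d) x.
  rewrite (ler_pM2l beta_gt0).
  have := dotv_ge0 u0 (proj1 xmin).
  rewrite dotvDl dotvNl -dotv_mulmx subr_ge0; apply: le_trans.
  by rewrite [dotv (lpb d) _]dotvC -dotvDr subrK.
move: var; rewrite -(ler_pM2l beta_gt0) mulr0 mulrDr mulVKf ?gt_eqF //.
rewrite (dotvDr (lpc d)) (dotvNr (lpc d)).
have -> : xstar - x = xstar - xbar - p by rewrite /p opprB addrA subrK.
rewrite -kE {}/q; move: r p {Ah} => r p.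
rewrite !dotv_lin (dotvC r ustar) (dotvC r ubar).
by split; lra.
Qed.

(** The two step bounds together give p.(P - p) + q.(Q - q) >= 0, where P and Q are the
    displacements to xstar and ustar. As 2 p.(P - p) <= |P|^2 - |p|^2, this yields |q|^2 <= 2 C^2.
    For the objective, p.(P - p) <= |P|^2 / 4 is used instead. *)
Lemma proximal_residual_le d ubar xbar (beta C : R) xstar ustar x :
  0 < beta -> primal_optimal d xstar -> dual_optimal d ustar ->
  minimizes_f_beta d ubar xbar beta x ->
  enorm (xstar - xbar) <= C -> enorm (ustar - ubar) <= C ->
  beta * enorm (lpA d *m x - lpb d) <= Num.sqrt 2 * C /\
  beta * `|dotv (lpc d) x - dotv (lpc d) xstar|
    <= C ^+ 2 + enorm ustar * (Num.sqrt 2 * C).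
Proof.
move=> b0 xopt uopt xmin xC uC; have C0 := le_trans (enorm_ge0 _) xC.
have [] := proximal_step_bounds b0 xopt uopt xmin.
have -> : beta * enorm (lpA d *m x - lpb d) =
    enorm (- (beta *: (lpA d *m x - lpb d))) by rewrite enormN enormZ gtr0_norm.
have {}xC : enorm (xstar - xbar) ^+ 2 <= C ^+ 2.
  by rewrite ler_pXn2r ?nnegrE ?enorm_ge0.
have {}uC : enorm (ustar - ubar) ^+ 2 <= C ^+ 2.
  by rewrite ler_pXn2r ?nnegrE ?enorm_ge0.
move: xC uC; set D := dotv (lpc d) x - _.
move: (x - xbar) (xstar - xbar) (- (beta *: _)) (ustar - ubar) => p P q Q.
move=> xC uC hi lo.
have le1 k (v w : 'cV[R]_k) : dotv v (w - v) <= (enorm w ^+ 2 - enorm v ^+ 2) / 2.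
  by have := dotvv_ge0 (v - w); rewrite !sqr_enorm !dotv_lin (dotvC w v); lra.
have le2 k (v w : 'cV[R]_k) : dotv v (w - v) <= enorm w ^+ 2 / 4.
  have := dotvv_ge0 (v - 2^-1 *: w); rewrite !sqr_enorm !dotv_lin (dotvC w v).
  by lra.
have qC : enorm q <= Num.sqrt 2 * C.
  rewrite -(@ler_pXn2r _ 2) ?nnegrE ?mulr_ge0 ?sqrtr_ge0 ?enorm_ge0 //.
  rewrite exprMn (sqr_sqrtr (ler0n R 2)).
  by have := le1 _ p P; have := le1 _ q Q; have := sqr_ge0 (enorm p); lra.
split=> //.
have uq : `|dotv ustar q| <= enorm ustar * (Num.sqrt 2 * C).
  by rewrite (le_trans (cauchy_schwarz _ _)) // ler_wpM2l ?enorm_ge0.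
rewrite -[X in X * _](gtr0_norm b0) -normrM ler_norml.
move: uq; rewrite ler_norml => /andP[uq1 uq2].
have := le2 _ p P; have := le2 _ q Q; have := sqr_ge0 C.
by move=> *; apply/andP; split; lra.
Qed.

End LinearProgram.

(** * Error bounds for the approximate minimizer *)

Theorem theorem5 (R : realType) (m n : nat)
    (A : 'M[R]_(m, n)) (b : 'cV[R]_m) (c : 'cV[R]_n)
    (xstar : 'cV[R]_n) (ustar : 'cV[R]_m)
    (ubar : 'cV[R]_m) (xbar : 'cV[R]_n)
    (eps delta beta : R) (xbeta xhat : 'cV[R]_n) :
  let d : lpdata R m n := (A, b, c) in
  let dP := delta_P d in
  let dD := delta_D d in
  let Cstar := Num.max (enorm (xstar - xbar)) (enorm (ustar - ubar)) in
  let C20 := 25 * Cstar / (2 * dnorm d * dP * dD) in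
  let epsbar := C20 ^+ 2 / beta ^+ 3 in
  let f := f_beta d ubar xbar beta in
  \rank A = m ->
  0 < dP -> 0 < dD ->
  primal_optimal d xstar -> dual_optimal d ustar ->
  dotv c xstar != 0 ->
  0 < eps -> 0 < delta -> 0 < beta ->
  10 * Cstar / (dnorm d * Num.min dP dD) <= beta ->
  (delta * `|dotv c xstar|)^-1 *
    (25 * Cstar / (dP * dD) + 6 * Cstar ^+ 2
     + Num.sqrt 6 * enorm xbar * Cstar) <= beta ->
  eps^-1 * ((1 + Num.sqrt 2) * Cstar + 25 * Cstar / (2 * dP * dD)) <= beta ->
  minimizes_f_beta d ubar xbar beta xbeta ->
  nonneg xhat ->
  beta^-1 * enorm (xhat - xbeta) ^+ 2 <= f xhat - f xbeta ->
  f xhat - f xbeta <= epsbar ->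
  `|A *m xhat - b| <= eps /\
  `|dotv c xhat - dotv c xstar| <= delta * `|dotv c xstar|.
Proof.
move=> d dP dD C C20 epsbar f _ dP0 dD0 xopt uopt k0 eps0 delta0 b0 _ hdelta heps.
move=> xmin _ near_lo near_hi.
have xC : enorm (xstar - xbar) <= C by rewrite le_max lexx.
have uC : enorm (ustar - ubar) <= C by rewrite le_max lexx orbT.
have C0 : 0 <= C := le_trans (enorm_ge0 _) xC.
have N0 : 0 < dnorm d.
  rewrite lt_neqAle dnorm_ge0 andbT; apply/eqP => N0.
  by move: dP0; rewrite /dP /delta_P -N0 invr0 mulr0 ltxx.
have uW := enorm_dual_optimal_le dP0 dD0 xopt uopt k0.
have [resC objC] := proximal_residual_le b0 xopt uopt xmin xC uC.
rewrite -/dP -/dD in uW; rewrite /d /lpA /lpb /lpc /= in resC objC.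
set W := (dP * dD)^-1 in uW hdelta.
have W0 : 0 < W by rewrite invr_gt0 mulr_gt0.
set N := dnorm d in N0; set e := enorm (xhat - xbeta).
(* The two conditions on xhat give e^2 / beta <= C20^2 / beta^3, that is beta e <= C20. *)
have near : beta * (N * e) <= 25 / 2 * C * W.
  have C20E : N * C20 = 25 / 2 * C * W.
    by rewrite /C20 /W -/N; field; rewrite !gt_eqF.
  have C20_ge0 : 0 <= C20.
    by rewrite -(pmulr_rge0 _ N0) C20E !mulr_ge0 // ltW.
  rewrite -C20E mulrCA ler_pM2l // -(@ler_pXn2r _ 2) ?nnegrE //; last first.
    by rewrite mulr_ge0 ?enorm_ge0 // ltW.
  have := le_trans near_lo near_hi; rewrite -/e /epsbar.
  rewrite ler_pdivlMr ?exprn_gt0 //; congr (_ <= _).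
  by field; rewrite gt_eqF.
have eps_le : (1 + Num.sqrt 2) * C + 25 / 2 * C * W <= beta * eps.
  move: heps; rewrite mulrC ler_pdivrMr //; congr (_ + _ <= _).
  by rewrite /W; field; rewrite !gt_eqF.
have kd0 : 0 < delta * `|dotv c xstar| by rewrite mulr_gt0 // normr_gt0.
move: hdelta; rewrite mulrC ler_pdivrMr // => hdelta.
split.
  have : enorm (A *m xhat - b) <= eps.
    (* The residual at xbeta contributes sqrt 2 C / beta, the distance from xhat to xbeta the term
       with W. *)
    have -> : A *m xhat - b = (A *m xbeta - b) + A *m (xhat - xbeta).
      by rewrite mulmxBr [RHS]addrC addrA subrK.
    apply: le_trans (le_enormD _ _) _; rewrite -(ler_pM2l b0) mulrDr.
    have : beta * enorm (A *m (xhat - xbeta)) <= beta * (N * e).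
      rewrite ler_pM2l //; apply: le_trans (enorm_mulmx _ _) _.
      by rewrite ler_wpM2r ?enorm_ge0 // (fnorm_le_dnorm d).
    by lra.
  (* The library norm is a maximum of absolute entries starting from 0, hence the side goal 0 <=
     eps. *)
  move=> hA; rewrite /Num.norm /= mx_normrE; apply: bigmax_le; first exact: ltW.
  move=> -[i j] _; rewrite ord1 /=; exact: le_trans (ler_coord_enorm _ _) hA.
have -> : dotv c xhat - dotv c xstar =
    dotv c (xhat - xbeta) + (dotv c xbeta - dotv c xstar).
  by rewrite !dotv_lin; ring.
apply: le_trans (ler_normD _ _) _; rewrite -(ler_pM2l b0) mulrDr.
apply: le_trans hdelta.
have : beta * `|dotv c (xhat - xbeta)| <= beta * (N * e).
  rewrite ler_pM2l //; apply: le_trans (cauchy_schwarz _ _) _.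
  by rewrite ler_wpM2r ?enorm_ge0 // (enormc_le_dnorm d).
(* With sqrt 2 <= 2 this term is at most 6 C W. The total 25/2 C W + C^2 + 6 C W stays below 25 C W
   + 6 C^2. *)
have : enorm ustar * (Num.sqrt 2 * C) <= 3 * W * (2 * C).
  have s2 : Num.sqrt 2 <= 2 :> R.
    by rewrite -(@ler_pXn2r _ 2) ?nnegrE ?sqrtr_ge0 // sqr_sqrtr //; lra.
  by rewrite ler_pM ?enorm_ge0 ?mulr_ge0 ?sqrtr_ge0 ?ler_wpM2r.
have : 0 <= Num.sqrt 6 * enorm xbar * C.
  by rewrite !mulr_ge0 ?sqrtr_ge0 ?enorm_ge0.
have := sqr_ge0 C; have := mulr_ge0 C0 (ltW W0).
by lra.
Qed.
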